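(* Let $\mathcal{B}$ be a bi-democratic and unconditional basis for a Banach space $\mathbb{X}$ over $\mathbb{F}\in\{\mathbb{R},\mathbb{C}\}$, and let $\kappa=2$ if $\mathbb{F}=\mathbb{R}$ and $\kappa=4$ if $\mathbb{F}=\mathbb{C}$. Then \[ C_g[\mathcal{B},\mathbb{X}]\le K_{su}[\mathcal{B},\mathbb{X}]+\kappa^2\,\Delta_b[\mathcal{B},\mathbb{X}]. \]
   Context: Bases. A (Markushevich) basis of an infinite-dimensional separable Banach space $\mathbb{X}$ is a countable family $\mathcal{B}=(\mathbf{x}_j)_{j\in J}$ with closed linear span $\mathbb{X}$ for which there are (uniquely determined) functionals $\mathbf{x}_j^*\in\mathbb{X}^*$ (coordinate functionals) with $\mathbf{x}_j^*(\mathbf{x}_k)=\delta_{jk}$ and with weak$^*$-closed linear span $\mathbb{X}^*$. Standing assumption: $\mathcal{B}$ is semi-normalized and $M$-bounded, equivalently $\sup_j\max\{\|\mathbf{x}_j\|,\|\mathbf{x}_j^*\|\}<\infty$. Unconditionality. For finite $A\subseteq J$ let $S_A(f)=\sum_{j\in A}\mathbf{x}_j^*(f)\,\mathbf{x}_j$. The suppression unconditional constant is $K_{su}[\mathcal{B},\mathbb{X}]=\sup_{A\subseteq J,\,|A|<\infty}\|\mathrm{Id}_{\mathbb{X}}-S_A\|$ (which equals $\sup_{|A|<\infty}\|S_A\|$); $\mathcal{B}$ is unconditional if, for every $f\in\mathbb{X}$, the series $\sum_{j\in J}\mathbf{x}_j^*(f)\,\mathbf{x}_j$ converges unconditionally to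 $f$, equivalently if $K_{su}[\mathcal{B},\mathbb{X}]<\infty$. Bi-democracy. $\Delta_b[\mathcal{B},\mathbb{X}]$ is the smallest constant $C$ such that $\|\sum_{j\in A}\mathbf{x}_j\|\,\|\sum_{k\in B}\mathbf{x}_k^*\|\le Cm$ for all $m\in\mathbb{N}$ and all $A,B\subseteq J$ with $|A|=|B|=m$; $\mathcal{B}$ is bi-democratic if $\Delta_b[\mathcal{B},\mathbb{X}]<\infty$. Greedy algorithm. Fix a bijection $\sigma\colon J\to\mathbb{N}$. For $f\in\mathbb{X}$ the family $(\mathbf{x}_j^*(f))_{j\in J}$ belongs to $c_0(J)$. The greedy ordering of $f$ is the unique one-to-one map $\rho\colon\mathbb{N}\to J$ such that $(|\mathbf{x}_{\rho(m)}^*(f)|)_{m}$ is the non-increasing rearrangement of $(|\mathbf{x}_j^*(f)|)_{j\in J}$, with ties resolved by $\sigma$ (i.e. $\sigma(\rho(m))\le\sigma(\rho(n))$ whenever $m\le n$ and $|\mathbf{x}_{\rho(m)}^*(f)|=|\mathbf{x}_{\rho(n)}^*(f)|$), and such that $\rho(\mathbb{N})=\{j:\mathbf{x}_j^*(f)\neq0\}$ if this set is infinite and $\rho(\mathbb{N})=J$ if it is finite. Put $\mathcal{G}_m(f)=\sum_{n=1}^m\mathbf{x}_{\rho(n)}^*(f)\,\mathbf{x}_{\rho(n)}$. Greedy constant. $C_g[\mathcal{B},\mathbb{X}]$ is the smallest constant $C\in[1,\infty]$ such that for all $m\in\mathbb{N}$, all $f\in\mathbb{X}$, all $A\subseteq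 J$ with $|A|=m$ and all scalars $(a_j)_{j\in A}$, $\|f-\mathcal{G}_m(f)\|\le C\|f-\sum_{j\in A}a_j\mathbf{x}_j\|$. *)

(* Defs.v *)
From HB Require Import structures.
From mathcomp Require Import all_boot all_order all_algebra finmap.
From mathcomp Require Import all_classical all_reals all_analysis.
From mathcomp Require Import complex.

Set Implicit Arguments.
Unset Strict Implicit.
Unset Printing Implicit Defensive.

Import Order.TTheory GRing.Theory Num.Theory.
Import numFieldNormedType.Exports.

Local Open Scope fset_scope.
Local Open Scope classical_set_scope.
Local Open Scope ring_scope.

Variant field_kind := RealScalars | ComplexScalars.

Definition scalar_field (R : realType) (F : field_kind) : numFieldType :=
  match F with
  | RealScalars => R
  | ComplexScalars => R[i]%C
  end.

Definition scalar_re (R : realType) (F : field_kind) : scalar_field R F -> R :=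
  match F with
  | RealScalars => fun z => z
  | ComplexScalars => fun z => complex.Re z
  end.

Definition kappa (R : realType) (F : field_kind) : R :=
  match F with
  | RealScalars => 2
  | ComplexScalars => 4
  end.

(* In the library the norm of a module over a field K takes values in K, hence
   in R[i] when K = R[i]. These values are always real, and rnorm v is that
   norm seen as an element of R. *)
Definition rnorm (R : realType) (F : field_kind)
    (V : normedZmodType (scalar_field R F)) (v : V) : R :=
  scalar_re `|v|.

Section Bases.
Variables (R : realType) (F : field_kind).
Local Notation K := (scalar_field R F).
Variables (X : completeNormedModType K) (J : choiceType).

Definition op_norm (V : normedZmodType K) (T : X -> V) : \bar R :=
  ereal_sup [set (rnorm (T f))%:E | f in [set f : X | rnorm f <= 1]].

Variables (x : J -> X) (xs : J -> {linear X -> K^o}).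

(* The weak* topology of the dual of X is induced by the topology of pointwise
   convergence on X -> K. *)
Record markushevich_basis : Prop := MarkushevichBasis {
  basis_total :
    closure [set f : X | exists (A : {fset J}) (a : J -> K),
      f = \sum_(j <- A) a j *: x j] = setT;
  coord_continuous : forall j, continuous (xs j);
  biorthogonal : forall j k, xs j (x k) = (j == k)%:R;
  coord_total : forall g : {linear X -> K^o}, continuous g ->
    closure [set h : {ptws X -> K^o} | exists (A : {fset J}) (a : J -> K),
      h = fun f => \sum_(j <- A) a j * xs j f] (g : X -> K^o) }.

Definition seminormalized_Mbounded : Prop :=
  (ereal_sup [set Order.max (rnorm (x j))%:E (op_norm (xs j)) | j in [set: J]]
    < +oo)%E.

Definition coord_proj (A : {fset J}) (f : X) : X :=
  \sum_(j <- A) xs j f *: x j.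

Definition K_su : \bar R :=
  ereal_sup [set op_norm (fun f : X => f - coord_proj A f)
            | A in [set: {fset J}]].

Definition unconditional_basis : Prop :=
  forall (f : X) (pi : nat -> J), bijective pi ->
    series (fun n => xs (pi n) f *: x (pi n)) @ \oo --> f.

Definition Delta_b : \bar R :=
  ereal_inf [set C%:E | C in [set C : R |
    forall (m : nat) (A B : {fset J}), #|` A| = m -> #|` B| = m ->
      ((rnorm (\sum_(j <- A) x j)%R)%:E *
         op_norm (fun f : X => (\sum_(k <- B) xs k f)%R : K^o)
       <= (C * m%:R)%:E)%E]].

Definition bidemocratic : Prop := (Delta_b < +oo)%E.

Variable sigma : J -> nat.

Definition greedy_ordering (f : X) (rho : nat -> J) : Prop :=
  let supp := [set j | xs j f != 0] in
  [/\ injective rho,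
      forall m n, (m <= n)%N -> rnorm (xs (rho n) f) <= rnorm (xs (rho m) f),
      forall m n, (m <= n)%N -> rnorm (xs (rho m) f) = rnorm (xs (rho n) f) ->
        (sigma (rho m) <= sigma (rho n))%N,
      infinite_set supp -> range rho = supp
    & finite_set supp -> range rho = setT].

(* For a basis and a bijective sigma, f has exactly one greedy ordering, so the
   set below is a singleton. Here the positions rho 0, rho 1, ... of the greedy
   ordering start at 0. *)
Definition greedy_sum (m : nat) (f : X) : X :=
  get [set g : X | exists2 rho, greedy_ordering f rho &
    g = \sum_(n < m) xs (rho n) f *: x (rho n)].

Definition C_g : \bar R :=
  ereal_inf [set C%:E | C in [set C : R | 1 <= C /\
    forall (m : nat) (f : X) (A : {fset J}) (a : J -> K), #|` A| = m ->
      rnorm (f - greedy_sum m f) <= C * rnorm (f - \sum_(j <- A) a j *: x j)]].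

End Bases.

(* Main.v *)
Require Import Defs.
From HB Require Import structures.
From mathcomp Require Import all_boot all_order all_algebra finmap.
From mathcomp Require Import all_classical all_reals all_analysis.
From mathcomp Require Import complex lra.

Set Implicit Arguments.
Unset Strict Implicit.
Unset Printing Implicit Defensive.

Import Order.TTheory GRing.Theory Num.Theory.
Import numFieldNormedType.Exports.

Local Open Scope ring_scope.

(** Let [G] be the set chosen by the greedy algorithm for [f], let [A] be any
    set with [#|A| = #|G|], and let [g := f - \sum_(j in A) a_j x_j].  The
    coordinates of [f] and [g] agree off [A], and [Id - S_(A U G)] kills the
    span of the [x_j] with [j] in [A]; hence
    [[
      f - S_G f = (g - S_(A U G) g) + S_(A minus G) f.
    ]]
    The first term is at most [K_su * |g|].  The second one costs the factor
    [kappa ^ 2] times the bi-democracy constant [C], as follows.  Greediness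
    gives a threshold [t] with [|x_j^*(f)| <= t] off [G] and
    [|x_k^*(f)| >= t] on [G].

    - A vector whose coefficients lie in [[0, t]] is a convex combination of
      the vectors [t * \sum_(j in B) x_j], where [B] ranges over the subsets of
      the index set.  A scalar is a combination with nonnegative
      coefficients of the [kappa] directions [1, -1] (and [i, -i] over the
      complex numbers), so [|S_(A minus G) f|] is at most [kappa] times the
      largest [t * |\sum_(j in B) x_j|] with [B] inside [A minus G]
      ([rnorm_sum_le_bounded]).

    - For such a [B] choose [D] inside [G minus A] with [#|D| = #|B|], which is
      possible because [A minus G] and [G minus A] have the same size.  There
      [|x_k^*(g)| = |x_k^*(f)| >= t].  Splitting [D] by the direction of
      [x_k^*(g)] bounds [\sum_(k in D) |x_k^*(g)|] by [kappa] times the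
      largest [|\sum_(k in D') x_k^*(g)|] with [D'] inside [D]
      ([sum_rnorm_le_subsets]).  Bi-democracy pairs sets of equal size only;
      it extends to the pair [B], [D'] because [|\sum_(j in B) x_j| / #|B|] is
      at most the largest such ratio over the subsets of size [#|D'|]
      ([rnorm_sum_average]).  Altogether
      [t * #|B| * |\sum_(j in B) x_j| <= kappa * C * #|B| * |g|]
      ([min_coord_mul_rnorm_sum]).

    These steps are combined in [rnorm_sub_greedy_le].  It remains to see that
    greedy sums come from such sets [G], that is, that every [f] has a greedy
    ordering: the coordinates of [f] tend to zero because finite combinations
    of the basis are dense and the [x_j^*] are uniformly bounded
    ([coord_c0]), and an infinite set with a strict total order in which
    every element has finitely many predecessors is order isomorphic to the
    natural numbers ([enum_finite_initial]). *)

(** * Real-valued norms over real or complex scalars *)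

Lemma rnorm_complex (R : realType) (z : scalar_field R ComplexScalars) :
  rnorm z = Num.sqrt (complex.Re z ^+ 2 + complex.Im z ^+ 2).
Proof. exact: (congr1 (@complex.Re R) (normc_def z)). Qed.

Section Scalars.
Variables (R : realType) (F : field_kind).
Local Notation K := (scalar_field R F).

Definition real_scalar : R -> K :=
  match F return R -> scalar_field R F with
  | RealScalars => fun r => r
  | ComplexScalars => fun r => r%:C%C
  end.

Lemma scalar_reD (z w : K) : scalar_re (z + w) = scalar_re z + scalar_re w.
Proof. by case: F z w => //= -[a b] [c d]. Qed.

Lemma scalar_re0 : scalar_re (0 : K) = 0.
Proof. by case: F. Qed.

Lemma scalar_re1 : scalar_re (1 : K) = 1.
Proof. by case: F. Qed.

Lemma scalar_re_sum (I : Type) (s : seq I) (P : pred I) (z : I -> K) :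
  scalar_re (\sum_(i <- s | P i) z i) = \sum_(i <- s | P i) scalar_re (z i).
Proof. exact: (big_morph _ scalar_reD scalar_re0). Qed.

Lemma scalar_re_le (z w : K) : z <= w -> scalar_re z <= scalar_re w.
Proof. by case: F z w => //= z w; rewrite lecE => /andP[]. Qed.

Lemma scalar_re_lt (z w : K) : z < w -> scalar_re z < scalar_re w.
Proof. by case: F z w => //= z w; rewrite ltcE => /andP[]. Qed.

Lemma scalar_reM (z w : K) : 0 <= z -> 0 <= w ->
  scalar_re (z * w) = scalar_re z * scalar_re w.
Proof.
case: F z w => //= -[a b] [c d]; rewrite !lecE /= => /andP[/eqP-> _] /andP[/eqP-> _].
by rewrite mul0r subr0.
Qed.

Lemma scalar_re_norm (z : K) : scalar_re z <= rnorm z.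
Proof.
case: F z => [z|[a b]]; first exact: ler_norm.
rewrite rnorm_complex /=; apply: (le_trans (ler_norm a)).
by rewrite -sqrtr_sqr ler_wsqrtr // lerDl sqr_ge0.
Qed.

Lemma scalar_reK (z : K) : 0 <= z -> real_scalar (scalar_re z) = z.
Proof.
rewrite /real_scalar; case: F z => //= -[a b].
by rewrite lecE /= => /andP[/eqP-> _].
Qed.

Lemma real_scalarKr (r : R) : scalar_re (real_scalar r) = r.
Proof. by rewrite /real_scalar; case: F. Qed.

Lemma real_scalar_gt0 (r : R) : 0 < r -> 0 < real_scalar r.
Proof. by rewrite /real_scalar; case: F => //= r0; rewrite ltcR. Qed.

Lemma real_scalarD (r s : R) :
  real_scalar (r + s) = real_scalar r + real_scalar s.
Proof. by rewrite /real_scalar; case: F => //; rewrite rmorphD. Qed.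

Lemma real_scalarM (r s : R) :
  real_scalar (r * s) = real_scalar r * real_scalar s.
Proof. by rewrite /real_scalar; case: F => //; rewrite rmorphM. Qed.

Lemma real_scalar0 : real_scalar 0 = 0.
Proof. by rewrite /real_scalar; case: F. Qed.

Lemma real_scalar1 : real_scalar 1 = 1.
Proof. by rewrite /real_scalar; case: F. Qed.

Lemma rnorm_real_scalar (r : R) : rnorm (real_scalar r) = `|r|.
Proof.
rewrite /real_scalar; case: F => //.
by rewrite rnorm_complex /= expr0n addr0 sqrtr_sqr.
Qed.

Section Norm.
Variable V : normedModType K.
Implicit Types v w : V.

Lemma rnorm_ge0 v : 0 <= rnorm v.
Proof. by rewrite /rnorm -scalar_re0 scalar_re_le. Qed.

Lemma rnormD v w : rnorm (v + w) <= rnorm v + rnorm w.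
Proof. by rewrite /rnorm -scalar_reD scalar_re_le // ler_normD. Qed.

Lemma rnorm0 : rnorm (0 : V) = 0.
Proof. by rewrite /rnorm normr0 scalar_re0. Qed.

Lemma rnormZ (a : K) v : rnorm (a *: v) = rnorm a * rnorm v.
Proof. by rewrite /rnorm normrZ scalar_reM. Qed.

Lemma rnorm0_eq0 v : rnorm v = 0 -> v = 0.
Proof.
rewrite /rnorm => v0; apply/eqP; rewrite -normr_eq0 -(@scalar_reK `|v|) //.
by rewrite v0 real_scalar0.
Qed.

Lemma rnorm_sum (I : Type) (s : seq I) (P : pred I) (v : I -> V) :
  rnorm (\sum_(i <- s | P i) v i) <= \sum_(i <- s | P i) rnorm (v i).
Proof.
elim/big_ind2: _ => //; first by rewrite rnorm0.
by move=> v1 r1 v2 r2 h1 h2; apply: (le_trans (rnormD _ _)); apply: lerD.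
Qed.

Lemma rnormMn v n : rnorm (v *+ n) = rnorm v *+ n.
Proof.
rewrite /rnorm normrMn.
by elim: n => [|n IH]; rewrite ?mulr0n ?scalar_re0 // !mulrS scalar_reD IH.
Qed.

End Norm.

(** Every scalar is a combination of these unimodular numbers with nonnegative
    coefficients; their number is the constant [kappa]. *)
Definition directions : seq K :=
  match F return seq (scalar_field R F) with
  | RealScalars => [:: 1; -1]
  | ComplexScalars => [:: 1; -1; 'i%C; - 'i%C]
  end.

Lemma sum_directions (c : R) : \sum_(u <- directions) c = kappa R F * c.
Proof.
by rewrite /directions; case: F; rewrite /= !big_cons big_nil mulr_natl addr0 -?mulrS.
Qed.

Lemma kappa_ge1 : 1 <= kappa R F.
Proof. by rewrite /kappa; case: F; rewrite ler1n. Qed.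

Lemma kappa_ge0 : 0 <= kappa R F.
Proof. exact: le_trans ler01 kappa_ge1. Qed.

(** For a unimodular [u] the inverse is the conjugate, so this is the positive
    part of the real inner product of [u] and [z]. *)
Definition component (u z : K) : R := Num.max 0 (scalar_re (u^-1 * z)).

Lemma rnorm_direction u : u \in directions -> rnorm u = 1.
Proof.
rewrite /directions; case: F u => u; rewrite !inE.
  by case/orP => /eqP ->; rewrite /rnorm ?normrN normr1.
by case/or4P => /eqP ->; rewrite rnorm_complex /= ?oppr0 ?sqrrN ?expr0n
  ?expr1n ?addr0 ?add0r ?sqrtr1.
Qed.

Lemma component_ge0 u z : 0 <= component u z.
Proof. by rewrite /component le_max lexx. Qed.

Lemma component_le_rnorm u z : u \in directions -> component u z <= rnorm z.
Proof.
move=> hu; rewrite /component ge_max; apply/andP; split; first exact: (@rnorm_ge0 K^o).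
apply: (le_trans (scalar_re_norm _)).
rewrite /rnorm normrM scalar_reM // normfV.
have -> : `|u| = 1.
  by rewrite -(@scalar_reK `|u|) // [scalar_re _]rnorm_direction // real_scalar1.
by rewrite invr1 scalar_re1 mul1r.
Qed.

Lemma sum_component z :
  \sum_(u <- directions) real_scalar (component u z) * u = z.
Proof.
have pos_neg_part (c : R) : Num.max 0 c - Num.max 0 (- c) = c.
  by case: (lerP 0 c) => hc; case: (lerP 0 (- c)) => hc' /=; lra.
rewrite /component /real_scalar /directions; case: F z => /= z.
  rewrite !big_cons big_nil /= invrN invr1 mul1r mulN1r mulr1 mulrN1 addr0.
  exact: pos_neg_part.
have iV : ('i%C)^-1 = - 'i%C :> R[i].
  by apply/eqP; rewrite eq_complex /= !(expr0n, expr1n, add0r, oppr0, mul0r,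
     divr1, invr1) !eqxx.
rewrite !big_cons big_nil /= !invrN invr1 iV.
case: z => a b.
apply/eqP; rewrite eq_complex /=.
by rewrite !(oppr0, opprK, mul1r, mul0r, mulN1r, mulr1, mulr0, mulrN1, subr0,
             sub0r, addr0, add0r) !pos_neg_part !eqxx.
Qed.

Lemma rnorm_le_sum_component z :
  rnorm z <= \sum_(u <- directions) component u z.
Proof.
rewrite -[in leLHS](sum_component z).
apply: (le_trans (@rnorm_sum K^o _ _ _ _)).
rewrite !big_seq; apply: ler_sum => u hu.
rewrite (@rnormZ K^o) (rnorm_direction hu) mulr1 rnorm_real_scalar.
by rewrite ger0_norm ?component_ge0.
Qed.

End Scalars.

(** * Sums over subsets of a finite index set *)

Lemma sumr_const_fset (W : nmodType) (I : choiceType) (A : {fset I}) (w : W) :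
  \sum_(i <- A) w = w *+ #|` A|.
Proof. by rewrite big_const_seq count_predT iter_addr_0. Qed.

Section FiniteSums.
Variables (R : realType) (F : field_kind).
Local Notation K := (scalar_field R F).
Variables (V : normedModType K) (I : choiceType).
Implicit Types (v : I -> V) (A B D : {fset I}).

(** A point of a box is a convex combination of the vertices of the box, and the
    vertices are the sums of [v] over subsets.  The translation by [u] is what
    makes the induction go through: removing an index [a] replaces [u] by [u]
    or [u + v a]. *)
Lemma rnorm_convex_sum v A (lam : I -> R) (u : V) (M : R) :
  (forall i, i \in A -> 0 <= lam i <= 1) ->
  (forall B, (B `<=` A)%fset -> rnorm (u + \sum_(i <- B) v i) <= M) ->
  rnorm (u + \sum_(i <- A) real_scalar F (lam i) *: v i) <= M.
Proof.
elim/finSet_rect: A u => A IH u hlam hM.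
have [A0|[a aA]] := fset_0Vmem A.
  by move: (hM fset0); rewrite A0 !big_seq_fset0; apply; exact: fsub0set.
have [lam0 lam1] := andP (hlam a aA).
have IHw w : (forall B, (B `<=` A `\ a)%fset -> rnorm (w + \sum_(i <- B) v i) <= M) ->
    rnorm (w + \sum_(i <- (A `\ a)%fset) real_scalar F (lam i) *: v i) <= M.
  apply: IH; first exact: fproperD1.
  by move=> i /fsetD1P[_]; exact: hlam.
have h0 := IHw u _; have h1 := IHw (u + v a) _.
rewrite (big_fsetD1 a) //=.
set s := \sum_(i <- _) _ in h0 h1 *.
have -> : u + (real_scalar F (lam a) *: v a + s) =
    real_scalar F (1 - lam a) *: (u + s) + real_scalar F (lam a) *: (u + v a + s).
  have -> : real_scalar F (1 - lam a) = 1 - real_scalar F (lam a).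
    by apply/eqP; rewrite eq_sym subr_eq -real_scalarD subrK real_scalar1.
  rewrite scalerBl scale1r [u + v a + s]addrAC [_ *: (u + s + _)]scalerDr.
  by rewrite [RHS]addrA subrK [RHS]addrAC -[RHS]addrA.
apply: (le_trans (rnormD _ _)).
rewrite !rnormZ !rnorm_real_scalar !ger0_norm ?subr_ge0 //.
have hM0 : rnorm (u + s) <= M.
  by apply: h0 => B hB; apply: hM; exact: (fsubset_trans hB (fsubD1set _ _)).
have hM1 : rnorm (u + v a + s) <= M.
  apply: h1 => B hB.
  have aB : a \notin B by apply/negP => /(fsubsetP hB); rewrite !inE eqxx.
  rewrite -addrA -(big_fsetU1 _ _ aB); apply: hM.
  by rewrite fsubUset fsub1set aA /=; exact: (fsubset_trans hB (fsubD1set _ _)).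
have : (1 - lam a) * rnorm (u + s) <= (1 - lam a) * M.
  by apply: ler_wpM2l; rewrite ?subr_ge0.
have : lam a * rnorm (u + v a + s) <= lam a * M by apply: ler_wpM2l.
lra.
Qed.

(** The components of the [z i] along a fixed direction lie in [[0, t]], so each
    of the [kappa] directions contributes a point of a box. *)
Lemma rnorm_sum_le_bounded v A (z : I -> K) (t M : R) :
  (forall i, i \in A -> rnorm (z i) <= t) ->
  (forall B, (B `<=` A)%fset -> t * rnorm (\sum_(i <- B) v i) <= M) ->
  rnorm (\sum_(i <- A) z i *: v i) <= kappa R F * M.
Proof.
move=> hz hM.
have [A0|[a aA]] := fset_0Vmem A.
  have := hM fset0 (fsub0set _); rewrite big_seq_fset0 rnorm0 mulr0 => M0.
  by rewrite A0 big_seq_fset0 rnorm0 mulr_ge0 // (le_trans ler01) ?kappa_ge1.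
have t0 : 0 <= t := le_trans (@rnorm_ge0 R F K^o (z a)) (hz a aA).
have -> : \sum_(i <- A) z i *: v i = \sum_(u <- directions R F) u *:
    \sum_(i <- A) real_scalar F (component u (z i) / t) *: (real_scalar F t *: v i).
  transitivity (\sum_(i <- A) \sum_(u <- directions R F)
      (real_scalar F (component u (z i)) * u) *: v i).
    by apply: eq_bigr => i _; rewrite -scaler_suml sum_component.
  rewrite exchange_big /= [LHS]big_seq [RHS]big_seq; apply: eq_bigr => u hu.
  rewrite scaler_sumr [LHS]big_seq [RHS]big_seq; apply: eq_bigr => i iA.
  rewrite !scalerA -mulrA -real_scalarM mulrC; congr (_ * real_scalar F _ *: _).
  have [t00|tn0] := eqVneq t 0; last by rewrite divfK.
  rewrite t00 mulr0; apply/eqP; rewrite eq_le component_ge0 andbT -t00.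
  exact: (le_trans (component_le_rnorm _ hu) (hz i iA)).
rewrite -sum_directions; apply: (le_trans (rnorm_sum _ _ _)).
rewrite [leLHS]big_seq [leRHS]big_seq; apply: ler_sum => u hu.
rewrite rnormZ (rnorm_direction hu) mul1r -[\sum_(i <- A) _]add0r.
apply: rnorm_convex_sum => [i iA|B BA].
  rewrite divr_ge0 ?component_ge0 //=.
  (* For t = 0 the quotient is the default value 0. *)
  have [->|tn0] := eqVneq t 0; first by rewrite invr0 mulr0 ler01.
  rewrite ler_pdivrMr ?mul1r ?lt_neqAle 1?eq_sym ?tn0 //.
  exact: (le_trans (component_le_rnorm _ hu) (hz i iA)).
rewrite add0r -scaler_sumr rnormZ rnorm_real_scalar ger0_norm //.
exact: hM.
Qed.

(** For a direction [u], the sum of the components along [u] is attained on the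
    subset where they are positive; there it is the real part of a single
    rotated sum. *)
Lemma sum_rnorm_le_subsets A (z : I -> K) (M : R) :
  (forall B, (B `<=` A)%fset -> rnorm (\sum_(i <- B) z i) <= M) ->
  \sum_(i <- A) rnorm (z i) <= kappa R F * M.
Proof.
move=> hM; rewrite -sum_directions.
apply: (@le_trans _ _ (\sum_(i <- A) \sum_(u <- directions R F) component u (z i))).
  by apply: ler_sum => i _; exact: rnorm_le_sum_component.
rewrite exchange_big /= [leLHS]big_seq [leRHS]big_seq; apply: ler_sum => u hu.
pose B := [fset i in A | 0 < scalar_re (u^-1 * z i)]%fset.
apply: (@le_trans _ _ (component u (\sum_(i <- B) z i))); last first.
  apply: (le_trans (component_le_rnorm _ hu)); apply: hM.
  by apply/fsubsetP => i; rewrite !inE => /andP[].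
apply: (@le_trans _ _ (\sum_(i <- B) scalar_re (u^-1 * z i))); last first.
  by rewrite /component mulr_sumr scalar_re_sum le_max lexx orbT.
rewrite /B big_fset /= big_mkcond [leRHS]big_mkcond /=.
by apply: ler_sum => i _; rewrite /component; case: ltP.
Qed.

(** The ratio of the norm of the sum to the cardinal does not increase when one
    passes from [d]-subsets to larger sets: a sum over [n + 1] indices is [1 / n]
    times the sum of its [n + 1] subsums of [n] terms. *)
Lemma rnorm_sum_average v (d : nat) (r c : R) : (0 < d)%N -> 0 <= r ->
  (forall A, #|` A| = d -> rnorm (\sum_(i <- A) v i) * r <= c * d%:R) ->
  forall B, (d <= #|` B|)%N -> rnorm (\sum_(i <- B) v i) * r <= c * #|` B|%:R.
Proof.
move=> d0 r0 hd B hB; rewrite -(subnKC hB).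
move: (#|` B| - d)%N (subnKC hB) => n; elim: n B {hB} => [|n IH] B hB.
  by rewrite addn0 in hB *; apply: hd.
set S := \sum_(i <- B) v i.
have bB : #|` B| = (d + n).+1 by rewrite -hB addnS.
have eS : S *+ (d + n) = \sum_(i <- B) \sum_(j <- (B `\ i)%fset) v j.
  rewrite [RHS]big_seq (eq_bigr (fun i => S - v i)) -?big_seq; last first.
    by move=> i iB; rewrite /S (big_fsetD1 i iB) /= addrC addrK.
  by rewrite sumrB sumr_const_fset bB mulrSr addrK.
have dn0 : 0 < (d + n)%:R :> R by rewrite ltr0n addn_gt0 d0.
have hsum : rnorm S * (d + n)%:R * r <= (d + n).+1%:R * (c * (d + n)%:R).
  rewrite mulr_natr -rnormMn eS.
  apply: (le_trans (ler_wpM2r r0 (rnorm_sum _ _ _))).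
  rewrite mulr_suml mulr_natl -bB -sumr_const_fset.
  rewrite [leLHS]big_seq [leRHS]big_seq; apply: ler_sum => i iB.
  by apply: IH; apply/eqP; rewrite -eqSS -bB (cardfsD1 i) iB.
rewrite addnS -(ler_pM2r dn0); lra.
Qed.

End FiniteSums.

(** * Operator norms *)

Section OperatorNorm.
Variables (R : realType) (F : field_kind).
Local Notation K := (scalar_field R F).
Variables (X : completeNormedModType K) (V : normedModType K).

Lemma rnorm_le_op_norm (T : X -> V) : scalable T ->
  forall f, ((rnorm (T f))%:E <= op_norm T * (rnorm f)%:E)%E.
Proof.
move=> TZ f; have [f0|f0] := eqVneq (rnorm f) 0.
  have T0 : T f = 0 by rewrite (rnorm0_eq0 f0) -(scale0r 0) TZ scale0r.
  by rewrite f0 T0 rnorm0 mule0.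
have f_gt0 : 0 < rnorm f by rewrite lt_neqAle eq_sym f0 rnorm_ge0.
pose g := real_scalar F (rnorm f)^-1 *: f.
have fE : f = real_scalar F (rnorm f) *: g.
  by rewrite scalerA -real_scalarM mulfV // real_scalar1 scale1r.
have g1 : rnorm g = 1.
  by rewrite rnormZ rnorm_real_scalar ger0_norm ?invr_ge0 ?(ltW f_gt0) // mulVf.
rewrite [in leLHS]fE TZ rnormZ rnorm_real_scalar ger0_norm ?(ltW f_gt0) //.
rewrite mulrC EFinM; apply: lee_wpmul2r; first by rewrite lee_fin ltW.
by apply: ereal_sup_ubound; exists g => //=; rewrite g1.
Qed.

Lemma op_norm_le_bound (T : X -> V) (C : R) : scalable T ->
  (op_norm T <= C%:E)%E -> forall f, rnorm (T f) <= C * rnorm f.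
Proof.
move=> TZ TC f; rewrite -lee_fin EFinM.
apply: (le_trans (rnorm_le_op_norm TZ f)); apply: lee_wpmul2r => //.
by rewrite lee_fin rnorm_ge0.
Qed.

Lemma op_norm_ge0 (T : X -> V) : (0 <= op_norm T)%E.
Proof.
apply: (@le_trans _ _ (rnorm (T 0))%:E); first by rewrite lee_fin rnorm_ge0.
by apply: ereal_sup_ubound; exists 0 => //=; rewrite rnorm0 ler01.
Qed.

End OperatorNorm.

(** * The greedy inequality *)

Section GreedyInequality.
Variables (R : realType) (F : field_kind).
Local Notation K := (scalar_field R F).
Variables (X : completeNormedModType K) (J : choiceType).
Variables (x : J -> X) (xs : J -> {linear X -> K^o}).
Hypothesis biorth : forall j k, xs j (x k) = (j == k)%:R.
Implicit Types (A B D G : {fset J}) (f g : X).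

Lemma coord_lin_comb A (a : J -> K) k :
  xs k (\sum_(j <- A) a j *: x j) = if k \in A then a k else 0.
Proof.
rewrite linear_sum /=.
have kE j : xs k (a j *: x j) = if j == k then a k else 0.
  rewrite linearZ /= biorth eq_sym; case: eqP => [->|_]; first exact: mulr1.
  exact: mulr0.
case: ifP => kA.
  rewrite (big_fsetD1 k kA) /= kE eqxx big_seq big1 ?addr0 // => j /fsetD1P[jk _].
  by rewrite kE (negbTE jk).
rewrite big_seq big1 // => j jA; rewrite kE; case: eqP => // jk.
by rewrite -jk jA in kA.
Qed.

Lemma coord_proj_lin_comb A B (a : J -> K) : (A `<=` B)%fset ->
  coord_proj x xs B (\sum_(j <- A) a j *: x j) = \sum_(j <- A) a j *: x j.
Proof.
move=> AB; rewrite /coord_proj; symmetry.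
transitivity (\sum_(j <- A) xs j (\sum_(i <- A) a i *: x i) *: x j).
  by rewrite [LHS]big_seq [RHS]big_seq; apply: eq_bigr => j jA; rewrite coord_lin_comb jA.
apply: big_fset_incl => // j _ jA.
by rewrite coord_lin_comb (negbTE jA) scale0r.
Qed.

Lemma coord_projB B f g :
  coord_proj x xs B (f - g) = coord_proj x xs B f - coord_proj x xs B g.
Proof.
by rewrite /coord_proj -sumrB; apply: eq_bigr => j _; rewrite linearB scalerBl.
Qed.

Lemma coord_projU A G f : coord_proj x xs (A `|` G)%fset f =
  coord_proj x xs G f + coord_proj x xs (A `\` G)%fset f.
Proof.
rewrite /coord_proj (big_fsetID _ (fun j => j \in G)).
by congr (_ + _); apply: eq_fbigl => j; rewrite !inE /=;
  case: (j \in G); case: (j \in A).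
Qed.

Lemma coord_proj_scalable B : scalable (coord_proj x xs B).
Proof.
move=> a f; rewrite /coord_proj scaler_sumr; apply: eq_bigr => j _.
by rewrite linearZ /= scalerA.
Qed.

(** The form in which bi-democracy is used: operator norms are replaced by
    values at [g], which keeps every quantity finite. *)
Definition pairing_bound (C : R) := forall A B g, #|` A| = #|` B| ->
  rnorm (\sum_(j <- A) x j) * rnorm (\sum_(k <- B) xs k g : K^o)
    <= C * #|` A|%:R * rnorm g.

Definition bidemocratic_with (C : R) := forall (m : nat) A B,
  #|` A| = m -> #|` B| = m ->
  ((rnorm (\sum_(j <- A) x j)%R)%:E *
     op_norm (fun f : X => (\sum_(k <- B) xs k f)%R : K^o)
   <= (C * m%:R)%:E)%E.

Lemma pairing_bound_of_bidemocratic (C : R) :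
  bidemocratic_with C -> pairing_bound C.
Proof.
move=> hC A B g AB; rewrite -lee_fin !EFinM.
have hs : scalable (fun f : X => (\sum_(k <- B) xs k f)%R : K^o).
  by move=> a f; rewrite scaler_sumr; apply: eq_bigr => k _; rewrite linearZ.
apply: (@le_trans _ _ ((rnorm (\sum_(j <- A) x j)%R)%:E *
   (op_norm (fun f : X => (\sum_(k <- B) xs k f)%R : K^o) * (rnorm g)%:E))%E).
  apply: lee_wpmul2l; first by rewrite lee_fin rnorm_ge0.
  exact: (rnorm_le_op_norm hs g).
rewrite muleA -EFinM; apply: lee_wpmul2r; first by rewrite lee_fin rnorm_ge0.
exact: hC.
Qed.

Lemma pairing_bound_ge1 (C : R) (j : J) : pairing_bound C -> 1 <= C.
Proof.
move=> /(_ [fset j]%fset [fset j]%fset (x j) erefl).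
rewrite !big_seq_fset1 cardfs1 biorth eqxx mulr1.
have xj0 : rnorm (x j) != 0.
  apply/eqP => /rnorm0_eq0 x0; have := biorth j j.
  by rewrite x0 linear0 eqxx => /esym/eqP; rewrite oner_eq0.
have xj_gt0 : 0 < rnorm (x j) by rewrite lt_neqAle eq_sym xj0 rnorm_ge0.
have -> : rnorm (true%:R : K^o) = 1 by rewrite /rnorm normr1 scalar_re1.
by rewrite mulrC ler_pM2r.
Qed.

Section Pairing.
Variable C : R.
Hypotheses (C_ge0 : 0 <= C) (hC : pairing_bound C).

(** Averaging over the subsets of [B] of size [#|D|] extends the bound to sets
    [D] smaller than [B]. *)
Lemma pairing_bound_mono B D g : (#|` D| <= #|` B|)%N ->
  rnorm (\sum_(j <- B) x j) * rnorm (\sum_(k <- D) xs k g : K^o)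
    <= C * #|` B|%:R * rnorm g.
Proof.
move=> DB; have [D0|] := eqVneq D fset0.
  by rewrite D0 big_seq_fset0 rnorm0 mulr0 !mulr_ge0 ?rnorm_ge0.
rewrite -cardfs_gt0 => D_gt0; rewrite mulrAC.
apply: (rnorm_sum_average D_gt0) => //; first exact: rnorm_ge0.
by move=> A AD; rewrite mulrAC -AD; exact: hC.
Qed.

Lemma rnorm_sum_mul_coords B D g : #|` D| = #|` B| ->
  rnorm (\sum_(j <- B) x j) * (\sum_(k <- D) rnorm (xs k g))
    <= kappa R F * (C * #|` B|%:R * rnorm g).
Proof.
move=> DB; pose b := rnorm (\sum_(j <- B) x j); rewrite -/b.
have b0 : 0 <= b by exact: rnorm_ge0.
have -> : b * (\sum_(k <- D) rnorm (xs k g)) =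
    \sum_(k <- D) rnorm (real_scalar F b *: xs k g : K^o).
  rewrite mulr_sumr; apply: eq_bigr => k _.
  by rewrite rnormZ rnorm_real_scalar ger0_norm.
apply: sum_rnorm_le_subsets => A AD.
rewrite -(@scaler_sumr _ K^o) rnormZ rnorm_real_scalar ger0_norm //.
by apply: pairing_bound_mono; rewrite -DB fsubset_leq_card.
Qed.

Lemma min_coord_mul_rnorm_sum B D g (t : R) : (#|` B| <= #|` D|)%N ->
  (forall k, k \in D -> t <= rnorm (xs k g)) ->
  t * rnorm (\sum_(j <- B) x j) <= kappa R F * (C * rnorm g).
Proof.
move=> BD ht; have [B0|] := eqVneq B fset0.
  by rewrite B0 big_seq_fset0 rnorm0 mulr0 !mulr_ge0 ?rnorm_ge0 ?kappa_ge0.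
rewrite -cardfs_gt0 => B_gt0.
pose E := [fset k in take #|` B| D]%fset.
have ED : (E `<=` D)%fset by apply/fsubsetP => k; rewrite inE => /mem_take.
have EB : #|` E| = #|` B|.
  by rewrite card_fseq undup_id ?take_uniq ?fset_uniq // size_takel.
have := rnorm_sum_mul_coords g EB.
have hE : t * #|` B|%:R <= \sum_(k <- E) rnorm (xs k g).
  rewrite -EB mulr_natr -sumr_const_fset [leLHS]big_seq [leRHS]big_seq.
  by apply: ler_sum => k kE; apply: ht; exact: (fsubsetP ED).
have {}hE := ler_wpM2l (rnorm_ge0 (\sum_(j <- B) x j)) hE.
move=> /(le_trans hE) h.
have B_gt0' : 0 < #|` B|%:R :> R by rewrite ltr0n.
rewrite -(ler_pM2r B_gt0'); lra.
Qed.

(** The inequality defining the greedy constant, for any set [G] separated from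
    its complement by a threshold [t]. *)
Lemma rnorm_sub_greedy_le (S : R) A G (a : J -> K) f (t : R) :
  (forall B g, rnorm (g - coord_proj x xs B g) <= S * rnorm g) ->
  #|` A| = #|` G| ->
  (forall k, k \in G -> t <= rnorm (xs k f)) ->
  (forall j, j \notin G -> rnorm (xs j f) <= t) ->
  rnorm (f - coord_proj x xs G f) <=
    (S + kappa R F ^+ 2 * C) * rnorm (f - \sum_(j <- A) a j *: x j).
Proof.
move=> hS AG tG tA; set h := \sum_(j <- A) _; pose g := f - h.
have -> : f - coord_proj x xs G f =
    (g - coord_proj x xs (A `|` G)%fset g) + coord_proj x xs (A `\` G)%fset f.
  rewrite coord_projB (coord_proj_lin_comb _ (fsubsetUl A G)) -/h coord_projU.
  by rewrite !opprB addrA subrK opprD addrA subrK.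
apply: (le_trans (rnormD _ _)); rewrite mulrDl lerD ?hS //.
rewrite expr2 -!mulrA; apply: rnorm_sum_le_bounded => [j|B BA].
  by rewrite inE => /andP[jG _]; exact: tA.
have AGcard : #|` (A `\` G)%fset| = #|` (G `\` A)%fset| by rewrite !cardfsD fsetIC AG.
apply: (@min_coord_mul_rnorm_sum B (G `\` A)%fset).
  by rewrite -AGcard; exact: fsubset_leq_card.
move=> k; rewrite inE => /andP[kA kG].
by rewrite linearB coord_lin_comb (negbTE kA) subr0; exact: tG.
Qed.

End Pairing.

End GreedyInequality.

(** * Enumerating orders with finite initial segments *)

Section Enumeration.
Local Open Scope classical_set_scope.

(** Each value of [e] is the least element of [S] beyond the previous one, so no
    element of [S] is skipped. *)
Lemma infinite_nat_enum (S : set nat) : infinite_set S ->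
  exists e : nat -> nat, (forall m n, (m < n)%N -> (e m < e n)%N) /\ range e = S.
Proof.
move=> Sinf.
have nextP k : exists i, `[< S i /\ (k <= i)%N >].
  apply: contrapT => hk; apply: Sinf; apply: (@sub_finite_set _ _ `I_k) => //.
  move=> i Si /=; rewrite ltnNge; apply/negP => ki; apply: hk.
  by exists i; apply/asboolP.
pose next k := ex_minn (nextP k).
have next_S k : S (next k) by rewrite /next; case: ex_minnP => i /asboolP[].
have next_ge k : (k <= next k)%N by rewrite /next; case: ex_minnP => i /asboolP[].
have next_min k i : S i -> (k <= i)%N -> (next k <= i)%N.
  by move=> Si ki; rewrite /next; case: ex_minnP => j _; apply; apply/asboolP.
pose e n := iteri n (fun _ i => next i.+1) (next 0%N).
have eS n : (e n < e n.+1)%N by rewrite /e /=; exact: next_ge.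
have e_mono m n : (m < n)%N -> (e m < e n)%N by exact: (homo_ltn ltn_trans eS).
exists e; split=> //; apply/seteqP; split=> [_ [n _ <-]|i Si].
  by case: n => [|n]; exact: next_S.
have e_ge n : (n <= e n)%N by elim: n => // n IH; exact: (leq_ltn_trans IH (eS n)).
have [n ile nmin] := ex_minnP (ex_intro (fun n => (i <= e n)%N) i (e_ge i)).
exists n => //; apply/eqP; rewrite eqn_leq ile andbT.
case: n ile nmin => [|n] ile nmin; first exact: next_min.
by apply: next_min => //; rewrite ltnNge; apply/negP => /nmin; rewrite ltnn.
Qed.

(** Counting predecessors embeds [S] monotonically into the natural numbers;
    [rho] inverts this embedding along the increasing enumeration of its
    image. *)
Lemma enum_finite_initial (T : choiceType) (S : set T) (lt : T -> T -> Prop) :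
  infinite_set S ->
  (forall j, ~ lt j j) ->
  (forall i j k, lt i j -> lt j k -> lt i k) ->
  (forall j k, j <> k -> lt j k \/ lt k j) ->
  (forall k, S k -> finite_set [set j | S j /\ lt j k]) ->
  exists rho : nat -> T,
    (forall m n, (m < n)%N -> lt (rho m) (rho n)) /\ range rho = S.
Proof.
move=> Sinf ltxx lt_trans lt_total fin.
pose rank k := #|` fset_set [set j | S j /\ lt j k]|.
have rank_lt j k : S j -> S k -> lt j k -> (rank j < rank k)%N.
  move=> Sj Sk jk; apply: fproper_ltn_card; rewrite fproperE; apply/andP; split.
    apply/fsubsetP => i; rewrite !in_fset_set ?inE; [|exact: fin..].
    by move=> [Si ij]; split=> //; exact: lt_trans jk.
  apply/negP => /fsubsetP /(_ j); rewrite !in_fset_set ?inE; [|exact: fin..].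
  by move=> /(_ (conj Sj jk))[_ /ltxx].
have rank_inj : {in S &, injective rank}.
  move=> j k; rewrite !inE => Sj Sk jk; apply: contrapT => /lt_total[] h.
    by have := rank_lt _ _ Sj Sk h; rewrite jk ltnn.
  by have := rank_lt _ _ Sk Sj h; rewrite jk ltnn.
have [|e [e_mono eE]] := @infinite_nat_enum (rank @` S).
  by rewrite (eq_finite_set (inj_card_eq rank_inj)).
have rhoP n : exists j, S j /\ rank j = e n.
  have : (range e) (e n) by exists n.
  by rewrite eE => -[j Sj jn]; exists j.
have [rho rho_spec] := boolp.choice rhoP.
exists rho; split=> [m n mn|].
  have [Sm Em] := rho_spec m; have [Sn En] := rho_spec n.
  have := e_mono _ _ mn; rewrite -Em -En => rmn.
  have [mn_eq|/lt_total[//|h]] := pselect (rho m = rho n).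
    by rewrite mn_eq ltnn in rmn.
  by have := ltn_trans rmn (rank_lt _ _ Sn Sm h); rewrite ltnn.
apply/seteqP; split=> [_ [n _ <-]|j Sj]; first by have [] := rho_spec n.
have : (rank @` S) (rank j) by exists j.
rewrite -eE => -[n _ nj]; exists n => //.
have [Sn En] := rho_spec n.
by apply: rank_inj; rewrite ?inE // En.
Qed.

End Enumeration.

(** * Existence of greedy orderings *)

Section GreedyOrdering.
Local Open Scope classical_set_scope.
Variables (R : realType) (F : field_kind).
Local Notation K := (scalar_field R F).
Variables (X : completeNormedModType K) (J : choiceType).
Variables (x : J -> X) (xs : J -> {linear X -> K^o}).

Lemma seminormalized_coord_bound : seminormalized_Mbounded x xs ->
  exists2 M : R, 0 < M & forall j f, rnorm (xs j f) <= M * rnorm f.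
Proof.
rewrite /seminormalized_Mbounded; set s := ereal_sup _ => s_fin.
have xs_s j : (op_norm (xs j) <= s)%E.
  apply: (@le_trans _ _ (Order.max (rnorm (x j))%:E (op_norm (xs j)))).
    by rewrite le_max lexx orbT.
  by apply: ereal_sup_ubound; exists j.
exists (Num.max 1 (fine s)); first by rewrite lt_max ltr01.
move=> j; apply: op_norm_le_bound => [a f|]; first by rewrite linearZ.
have s0 : (0 <= s)%E by apply: (le_trans (op_norm_ge0 _) (xs_s j)).
rewrite (le_trans (xs_s j)) // -[leLHS]fineK ?ge0_fin_numE //.
by rewrite lee_fin le_max lexx orbT.
Qed.

(** If [f] is within [eps / M] of a combination supported in a finite set [A],
    then off [A] its coordinates are smaller than [eps]. *)
Lemma coord_c0 : markushevich_basis x xs -> seminormalized_Mbounded x xs ->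
  forall f (eps : R), 0 < eps -> finite_set [set j | eps <= rnorm (xs j f)].
Proof.
move=> hb /seminormalized_coord_bound[M M0 hM] f eps eps0.
have : closure [set f : X | exists (A : {fset J}) (a : J -> K),
      f = \sum_(j <- A) a j *: x j] f by rewrite (basis_total hb).
pose d := real_scalar F (eps / M).
have d0 : 0 < d by apply: real_scalar_gt0; rewrite divr_gt0.
move=> /(_ _ (nbhsx_ballx f d d0))[h [[A [a ->]]]].
rewrite -ball_normE /= => fh.
apply: (@sub_finite_set _ _ [set` A]); last exact: finite_fset.
move=> j /= hj; apply: contrapT => /negP jA.
have : rnorm (xs j (f - \sum_(j <- A) a j *: x j)) < eps.
  apply: (le_lt_trans (hM _ _)); rewrite mulrC -ltr_pdivlMr //.
  by have := scalar_re_lt fh; rewrite /d real_scalarKr.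
rewrite linearB (coord_lin_comb (biorthogonal hb)) (negbTE jA) subr0.
by rewrite ltNge hj.
Qed.

Variable sigma : J -> nat.
Hypothesis sigma_bij : bijective sigma.

(** The order compares moduli of coordinates, then [sigma].  It is restricted to
    the support of [f] when the support is infinite, since a zero coordinate
    would then have infinitely many predecessors. *)
Lemma greedy_ordering_exists f :
  (forall eps : R, 0 < eps -> finite_set [set j | eps <= rnorm (xs j f)]) ->
  exists rho, greedy_ordering xs sigma f rho.
Proof.
move=> c0.
pose supp := [set j | xs j f != 0].
pose S := [set j | finite_set supp \/ supp j].
pose c j := rnorm (xs j f).
pose lt j k := c k < c j \/ c j = c k /\ (sigma j < sigma k)%N.
have sigma_inj := bij_inj sigma_bij.
have Jinf : infinite_set [set: J].
  have [tau sigmaK tauK] := sigma_bij.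
  move=> Jfin; apply: infinite_nat.
  apply: (@sub_finite_set _ _ (sigma @` [set: J])); last exact: finite_image.
  by move=> n _; exists (tau n).
have Sinf : infinite_set S.
  have [fin|inf] := pselect (finite_set supp).
    by rewrite (_ : S = setT) //; apply/seteqP; split=> // j _; left.
  by rewrite (_ : S = supp) //; apply/seteqP; split=> [j []//|j]; right.
have lt_fin k : S k -> finite_set [set j | S j /\ lt j k].
  move=> Sk; have [k0|k0] := eqVneq (xs k f) 0.
    have sfin : finite_set supp by case: Sk => //; rewrite /supp /= k0 eqxx.
    apply: (@sub_finite_set _ _ (supp `|` sigma @^-1` `I_(sigma k))).
      move=> j [_ [jk|[_ jk]]]; [left|by right].
      apply/eqP => j0; move: jk; rewrite /c k0 j0 ltxx //.
    rewrite finite_setU; split=> //.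
    by apply: finite_preimage => // i j _ _; exact: sigma_inj.
  have ck : 0 < c k.
    rewrite lt_neqAle (@rnorm_ge0 _ _ K^o) andbT eq_sym; apply: contra_neq k0.
    exact: (@rnorm0_eq0 _ _ K^o).
  apply: sub_finite_set (c0 _ ck) => j [_ [/ltW//|[jk _]]].
  by rewrite /= -/(c j) jk.
have [rho [rho_lt rhoS]] : exists rho : nat -> J,
    (forall m n, (m < n)%N -> lt (rho m) (rho n)) /\ range rho = S.
  apply: enum_finite_initial => //.
  - by move=> j [|[_]]; rewrite ?ltxx ?ltnn.
  - move=> i j k [ij|[ij sij]] [jk|[jk sjk]].
    + by left; exact: lt_trans jk ij.
    + by left; rewrite -jk.
    + by left; rewrite ij.
    + by right; rewrite ij jk; split=> //; exact: ltn_trans sjk.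
  - move=> j k jk; case: (ltgtP (c j) (c k)) => h; [by right; left|by left; left|].
    case: (ltngtP (sigma j) (sigma k)) => sh.
    + by left; right.
    + by right; right.
    + by case: jk; exact: sigma_inj.
exists rho; split.
- move=> m n mn; case: (ltngtP m n) => // /rho_lt; rewrite mn => -[|[_]];
    by rewrite ?ltxx ?ltnn.
- move=> m n; rewrite leq_eqVlt => /predU1P[->//|/rho_lt[/ltW//|[e _]]].
  by move: e; rewrite /c => ->.
- move=> m n; rewrite leq_eqVlt => /predU1P[->//|/rho_lt[h e|[_ /ltnW//]]].
  by move: h; rewrite /c e ltxx.
- by move=> inf; rewrite rhoS; apply/seteqP; split=> [j []//|j]; right.
- by move=> fin; rewrite rhoS; apply/seteqP; split=> // j _; left.
Qed.

(** The threshold is the modulus of the first coordinate that the algorithm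
    does not select. *)
Lemma greedy_sum_coord_proj m f :
  (exists rho, greedy_ordering xs sigma f rho) ->
  exists G : {fset J}, exists t : R, [/\ #|` G| = m,
    greedy_sum x xs sigma m f = coord_proj x xs G f,
    (forall k, k \in G -> t <= rnorm (xs k f)) &
    (forall j, j \notin G -> rnorm (xs j f) <= t)].
Proof.
move=> [rho0 hrho0].
have [rho [rho_inj rho_le _ rho_inf rho_fin] ->] : exists2 rho,
    greedy_ordering xs sigma f rho &
    greedy_sum x xs sigma m f = \sum_(n < m) xs (rho n) f *: x (rho n).
  by have := @getPex X [set g : X | exists2 rho, greedy_ordering xs sigma f rho &
    g = \sum_(n < m) xs (rho n) f *: x (rho n)]; apply; eexists; exists rho0.
pose G := [fset rho n | n in iota 0 m]%fset.
exists G, (rnorm (xs (rho m) f)); split.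
- by rewrite card_imfset //= undup_id ?iota_uniq // size_iota.
- rewrite /coord_proj big_imfset /=; last by move=> ? ? _ _; exact: rho_inj.
  rewrite -(big_mkord xpredT (fun n => xs (rho n) f *: x (rho n))) /index_iota subn0.
  by rewrite undup_id ?iota_uniq.
- move=> k /imfsetP[n /=]; rewrite mem_iota add0n => /andP[_ nm] ->.
  by apply: rho_le; exact: ltnW.
move=> j jG; have [j0|j0] := eqVneq (xs j f) 0.
  by rewrite j0 rnorm0 (@rnorm_ge0 _ _ K^o).
have [n nj] : exists n, rho n = j.
  have : range rho j.
    have [fin|inf] := pselect (finite_set [set j | xs j f != 0]).
      by rewrite (rho_fin fin).
    by rewrite (rho_inf inf).
  by case=> n _ <-; exists n.
rewrite -nj; apply: rho_le; rewrite leqNgt; apply: contra jG => nm.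
by apply/imfsetP; exists n; rewrite //= mem_iota.
Qed.

End GreedyOrdering.

(** * The greedy constant *)

Theorem theorem1p4 (R : realType) (F : field_kind)
    (X : completeNormedModType (scalar_field R F))
    (J : choiceType) (sigma : J -> nat) (hsigma : bijective sigma)
    (x : J -> X) (xs : J -> {linear X -> (scalar_field R F)^o})
    (hbasis : markushevich_basis x xs)
    (hbounded : seminormalized_Mbounded x xs)
    (hbidem : bidemocratic x xs)
    (huncond : unconditional_basis x xs) :
  (C_g x xs sigma <= K_su x xs + (kappa R F ^+ 2)%:E * Delta_b x xs)%E.
Proof.
have biorth := biorthogonal hbasis.
have [tau _ _] := hsigma; pose j0 := tau 0%N.
have projZ B : scalable (fun f : X => f - coord_proj x xs B f).
  by move=> a f; rewrite coord_proj_scalable scalerBr.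
have K_ub B : (op_norm (fun f : X => f - coord_proj x xs B f)%R <= K_su x xs)%E.
  by apply: ereal_sup_ubound; exists B.
have K_ge0 := le_trans (op_norm_ge0 _) (K_ub fset0).
have Delta_ge1 : (1 <= Delta_b x xs)%E.
  apply: le_ereal_inf_tmp => _ [C hC <-]; rewrite lee_fin.
  exact: (pairing_bound_ge1 biorth j0 (pairing_bound_of_bidemocratic hC)).
have kappa2_ge1 : 1 <= kappa R F ^+ 2 := exprn_ege1 2 (kappa_ge1 R F).
have C_g_le (S C : R) : K_su x xs = S%:E ->
    bidemocratic_with x xs C ->
    (C_g x xs sigma <= (S + kappa R F ^+ 2 * C)%:E)%E.
  move=> KS /pairing_bound_of_bidemocratic hC.
  have C_ge1 := pairing_bound_ge1 biorth j0 hC.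
  apply: ereal_inf_lbound; exists (S + kappa R F ^+ 2 * C) => //; split.
    rewrite KS lee_fin in K_ge0.
    by rewrite -[leLHS]add0r lerD // -[leLHS]mulr1 ler_pM.
  move=> m f A a Am.
  have hf := greedy_ordering_exists hsigma (coord_c0 hbasis hbounded f).
  have [G [t [Gm -> tG tA]]] := greedy_sum_coord_proj x m hf.
  apply: (@rnorm_sub_greedy_le _ _ _ _ _ _ biorth C _ hC S A G a f t) => //.
  - exact: le_trans C_ge1.
  - by move=> B g; apply: (op_norm_le_bound (projZ B)); rewrite -KS.
  - by rewrite Am Gm.
case KE : (K_su x xs) => [S| |].
(* The bound for every admissible C passes to the infimum, one e at a time. *)
- have [d dE] : exists d : R, Delta_b x xs = d%:E.
    exists (fine (Delta_b x xs)); rewrite fineK // fin_numElt.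
    by rewrite (lt_le_trans _ Delta_ge1) ?ltNyr.
  rewrite dE -EFinM -EFinD; apply/lee_addgt0Pr => e e0.
  have k0 : 0 < kappa R F ^+ 2 by apply: lt_le_trans kappa2_ge1.
  have : (Delta_b x xs < (d + e / kappa R F ^+ 2)%:E)%E.
    by rewrite dE lte_fin ltrDl divr_gt0.
  move=> /ereal_inf_lt[_ [C hC <-]]; rewrite lte_fin => /ltW Cd.
  apply: (le_trans (C_g_le _ _ KE hC)).
  rewrite -EFinD lee_fin -addrA lerD2l.
  have := ler_wpM2l (ltW k0) Cd.
  by rewrite mulrDr mulrCA divff ?mulr1 ?gt_eqF.
- rewrite addye ?leey // -ltNye (lt_le_trans (ltNyr 0)) //.
  by rewrite mule_ge0 ?lee_fin ?(le_trans ler01) // (le_trans _ Delta_ge1) ?lee_fin.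
- by rewrite KE in K_ge0.
Qed.
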